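(* In the Online Ad-Auctions problem with predictions, with confidence parameter $\eta\in(0,1]$, Algorithm 2 is $(1-\eta)$-consistent and $\frac{1-1/C}{1+R_{\max}}$-robust, where $C=(1+R_{\max})^{\eta/R_{\max}}$. As $R_{\max}\to0$, the robustness $\frac{1-1/C}{1+R_{\max}}$ tends to $1-e^{-\eta}$.
   Context: Online Ad-Auctions with predictions: $n$ buyers, buyer $i$ with budget $B_i>0$. Items $j$ arrive online; on arrival of $j$, each buyer $i$ reveals a bid $b_{ij}\ge0$, and a predicted buyer $\texttt{pred}(j)\in\{0,1,\dots,n\}$ is revealed ($0$ meaning do not sell). Let $R_{\max}=\max_{i,j}b_{ij}/B_i$, assumed to lie in $(0,1]$ (bids small relative to budgets). Items are splittable; $x_{ij}\ge0$ is the fraction of $j$ sold to $i$; a feasible solution satisfies $\sum_i x_{ij}\le1$ and $\sum_j b_{ij}x_{ij}\le B_i$; revenue is $\sum_{i,j}b_{ij}x_{ij}$. $\mathcal{A}(I)$ is the revenue of the algorithm on instance $I$, $\mathcal{O}(I)$ the optimal offline revenue over feasible fractional solutions, and $\mathcal{P}(I)$ the revenue $\sum_j b_{\texttt{pred}(j)j}$ of the prediction if it is feasible ($\sum_{j:\texttt{pred}(j)=i}b_{ij}\le B_i$ for all $i$) and $0$ otherwise. An algorithm is $c$-consistent and $r$-robust if $\mathcal{A}(I)\ge\max\{c\,\mathcal{P}(I),r\,\mathcal{O}(I)\}$ for every instance $I$. A fictitious buyer $0$ with $b_{0j}=0$ receives unsold fractions. Algorithm 2: initially all $x_{ij},y_i,z_j$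 are $0$ and sets $N(i),M(i)$ are empty. For each arriving item $j$: let $i^*=\texttt{pred}(j)$, and set $i^*=0$ if the prediction is (detected to be) infeasible; let $i=\arg\max_{i'}\{b_{i'j}(1-y_{i'})\}$, and set $i=0$ if $b_{ij}(1-y_i)\le0$; set $z_j=\max\{0,b_{ij}(1-y_i)\}$. If $b_{ij}<b_{i^*j}$, set $x_{ij}=\eta$, $x_{i^*j}=1-\eta$ and add $j$ to $N(i^* )$; otherwise set $x_{ij}=1$. Add $j$ to $M(i)$, and update $y_i\leftarrow y_i(1+\frac{b_{ij}}{B_i})+\frac{b_{ij}}{B_i}\cdot\frac{1}{C-1}$ (only for $i\ge1$). *)

(* Defs.v *)
From HB Require Import structures.
From mathcomp Require Import all_boot all_order all_algebra.
From mathcomp Require Import all_classical all_reals all_analysis.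
Set Implicit Arguments.
Unset Strict Implicit.
Unset Printing Implicit Defensive.
Import Order.TTheory GRing.Theory Num.Theory.
Import numFieldNormedType.Exports.
Local Open Scope classical_set_scope.
Local Open Scope ring_scope.

(* [n] buyers and [m] items arriving in the order 0, 1, ..., m - 1.  In
   [option 'I_n], [None] is the fictitious buyer 0; as a prediction it means
   "do not sell". *)
Record instance (R : realType) (n m : nat) := Instance {
  budget : 'I_n -> R;
  bid : 'M[R]_(n, m);
  predicted : 'I_m -> option 'I_n;
  budget_gt0 : forall i, 0 < budget i;
  bid_ge0 : forall i j, 0 <= bid i j }.

Section AdAuctions.
Variables (R : realType) (n m : nat).
Implicit Types (I : instance R n m) (x : 'M[R]_(n, m)).

(* Bids are nonnegative, so starting the maximum at 0 is harmless. *)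
Definition Rmax I : R :=
  \big[Num.max/0]_(p : 'I_n * 'I_m) (bid I p.1 p.2 / budget I p.1).

Definition feasible I x : Prop :=
  [/\ forall i j, 0 <= x i j,
      forall j, \sum_i x i j <= 1
    & forall i, \sum_j bid I i j * x i j <= budget I i].

Definition revenue I x : R := \sum_i \sum_j bid I i j * x i j.

(* The feasible revenues contain 0 and are bounded by the total budget, so
   this supremum is a genuine one. *)
Definition opt I : R := sup [set revenue I x | x in feasible I].

Definition bid0 I (i : option 'I_n) (j : 'I_m) : R :=
  if i is Some k then bid I k j else 0.

Definition prediction_feasible I : bool :=
  [forall i, \sum_(j | predicted I j == Some i) bid I i j <= budget I i].

Definition prediction_revenue I : R :=
  if prediction_feasible I then \sum_j bid0 I (predicted I j) j else 0.

(* What is known on arrival of item [j]: all predictions and bids up to and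
   including those of [j]. *)
Definition detected_infeasible I (j : 'I_m) : bool :=
  ~~ [forall i, \sum_(l < m | (l <= j)%N && (predicted I l == Some i)) bid I i l
                  <= budget I i].

Record state := State {
  sx : option 'I_n -> 'I_m -> R;
  sy : 'I_n -> R;
  sz : 'I_m -> R;
  sN : option 'I_n -> {set 'I_m};
  sM : option 'I_n -> {set 'I_m} }.

Definition init_state : state :=
  State (fun _ _ => 0) (fun _ => 0) (fun _ => 0)
        (fun _ => finset.set0) (fun _ => finset.set0).

(* [i] is a maximiser of b_{i'j} (1 - y_{i'}), with ties broken arbitrarily,
   replaced by buyer 0 when the maximum is not positive. *)
Definition selected I (st : state) (j : 'I_m) (i : option 'I_n) : Prop :=
  let score k := bid I k j * (1 - sy st k) in
  if i is Some k then (forall k', score k' <= score k) /\ 0 < score k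
  else forall k', score k' <= 0.

Definition step (eta C : R) I (j : 'I_m) (i : option 'I_n) (st : state) :
    state :=
  let istar := if detected_infeasible I j then None else predicted I j in
  let split := bid0 I i j < bid0 I istar j in
  {| sx := fun k l =>
       if l != j then sx st k l
       else if split then
         (if k == i then eta else if k == istar then 1 - eta else 0)
       else (if k == i then 1 else 0);
     sy := fun k =>
       if Some k == i then
         sy st k * (1 + bid I k j / budget I k)
           + bid I k j / budget I k * (1 / (C - 1))
       else sy st k;
     sz := fun l =>
       if l != j then sz st l
       else if i is Some k then Num.max 0 (bid I k j * (1 - sy st k)) else 0;
     sN := fun k => if split && (k == istar) then (j |: sN st k)%SET else sN st k;
     sM := fun k => if k == i then (j |: sM st k)%SET else sM st k |}.

(* [exec eta C I k st]: [st] is reachable after the first [k] arrivals. *)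
Inductive exec (eta C : R) I : nat -> state -> Prop :=
| exec_init : exec eta C I 0 init_state
| exec_arrival (j : 'I_m) (i : option 'I_n) (st : state) :
    exec eta C I j st -> selected I st j i ->
    exec eta C I j.+1 (step eta C I j i st).

(* Every instance has at least one execution, so [exec] is never vacuous. *)
Lemma exec_total (eta C : R) I k :
  (k <= m)%N -> exists st, exec eta C I k st.
Proof.
elim: k => [_|k IH km]; first by eexists; exact: exec_init.
have [st hst] := IH (ltnW km).
have [i hi] : exists i, selected I st (Ordinal km) i.
  have [h|/existsNP[k0 hk0]] :=
    pselect (forall k', bid I k' (Ordinal km) * (1 - sy st k') <= 0).
    by exists None.
  pose f k' := bid I k' (Ordinal km) * (1 - sy st k').
  case: (@arg_maxP _ _ _ k0 xpredT f isT) => k1 _ hk1; exists (Some k1).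
  split; first by move=> k'; apply: hk1.
  by apply: lt_le_trans (hk1 k0 isT); rewrite ltNge; apply/negP.
by eexists; exact: (@exec_arrival _ _ _ (Ordinal km) i st hst hi).
Qed.

End AdAuctions.

Definition Cconst (R : realType) (eta r : R) : R := (1 + r) `^ (eta / r).

Definition robustness (R : realType) (eta r : R) : R :=
  (1 - 1 / Cconst eta r) / (1 + r).

(* The possible outputs of an algorithm on each instance; there may be several
   because ties are broken arbitrarily. *)
Definition algorithm (R : realType) : Type :=
  forall n m : nat, instance R n m -> 'M[R]_(n, m) -> Prop.

(* The algorithm tuned for instances whose bid-to-budget ratio is [r]. *)
Definition algorithm2 (R : realType) (eta r : R) : algorithm R :=
  fun n m I x =>
    exists2 st : state R n m, exec eta (Cconst eta r) I m st
      & x = \matrix_(i, j) sx st (Some i) j.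

(* [alg] is [c]-consistent and [rho]-robust on the instances with
   [Rmax I = r], for each of its possible outputs. *)
Definition consistent_robust (R : realType) (r : R) (alg : algorithm R)
    (c rho : R) : Prop :=
  forall (n m : nat) (I : instance R n m) (x : 'M[R]_(n, m)),
    Rmax I = r -> alg n m I x ->
    Num.max (c * prediction_revenue I) (rho * opt I) <= revenue I x.

(* Main.v *)
Require Import Defs.
From HB Require Import structures.
From mathcomp Require Import all_boot all_order all_algebra.
From mathcomp Require Import all_classical all_reals all_analysis.
From mathcomp Require Import ring lra.
Set Implicit Arguments.
Unset Strict Implicit.
Unset Printing Implicit Defensive.
Import Order.TTheory GRing.Theory Num.Theory.
Import numFieldNormedType.Exports.
Local Open Scope classical_set_scope.
Local Open Scope ring_scope.

(* Primal-dual.  Every item earns at least the winning bid [b], even when it is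
   split, while the dual objective [sum_i B_i y_i + sum_j z_j] grows by
   [b C / (C - 1)]; the final [(y, z)] is dual feasible, so weak duality gives
   the factor [1 - 1/C].  Every item also earns at least [1 - eta] times the
   bid of the predicted buyer.
   The budgets are exceeded by at most the factor [1 + r]: by Bernoulli,
   [1 + (C - 1) y_i >= (1 + r)^(S_i / (r B_i))], where [S_i] is the total bid of
   the items won by [i], so [y_i] reaches 1, and [i] stops winning, once
   [S_i >= eta B_i].  The winning bids thus total at most [(eta + r) B_i], and
   following the prediction adds at most [(1 - eta) B_i]. *)

(** * Estimates for powers and sums *)

(** Bernoulli's inequality for exponents in [[0, 1]]: convexity of the exponential between 0 and
    [ln (1 + r)]. *)
Lemma powR1D_le (R : realType) (r t : R) :
  0 <= r -> 0 <= t <= 1 -> (1 + r) `^ t <= 1 + t * r.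
Proof.
move=> r0 /andP[t0 t1]; have r1 : 0 < 1 + r by rewrite ltr_wpDr.
have := @convex_expR _ (Itv01 t0 t1) (ln (1 + r)) 0.
rewrite !convRE/= mulr0 addr0 expR0 mulr1 lnK ?posrE// /powR gt_eqF//.
by move/le_trans; apply; rewrite /unstable.onem; lra.
Qed.

Lemma Cconst_gt1 (R : realType) (eta r : R) :
  0 < eta -> 0 < r -> 1 < Cconst eta r.
Proof.
move=> eta0 r0; have r1 : 0 < 1 + r by rewrite addr_gt0.
rewrite /Cconst /powR gt_eqF// expR_gt1 mulr_gt0 ?divr_gt0//.
by rewrite ln_gt0// ltrDl.
Qed.

(** Since [f] vanishes at the fictitious buyer, a sum over real buyers can be evaluated at [o]
    without knowing whether [o] is [None]. *)
Lemma sum_option_pick (R : realType) (n : nat) (f : option 'I_n -> R)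
    (o : option 'I_n) (c : R) :
  f None = 0 -> \sum_k f (Some k) * (if Some k == o then c else 0) = f o * c.
Proof.
move=> f0; case: o => [i|]; last first.
  by rewrite f0 mul0r big1// => k _; rewrite mulr0.
rewrite (bigD1 i)//= eqxx big1 ?addr0// => k /negbTE ki.
by rewrite (inj_eq Some_inj) ki mulr0.
Qed.

Lemma sum_update (R : realType) (T : finType) (j : T) (f g : T -> R) :
  (forall l, l != j -> g l = f l) -> f j = 0 ->
  \sum_l g l = \sum_l f l + g j.
Proof.
move=> gf fj; rewrite (bigD1 j)//= [in RHS](bigD1 j)//= fj add0r addrC.
by rewrite (eq_bigr f)// => l; exact: gf.
Qed.

(** * The followed prediction and weak duality *)

Section Execution.
Variables (R : realType) (n m : nat) (I : instance R n m).

(** This is the buyer called [istar] in [step]. *)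
Definition followed (j : 'I_m) : option 'I_n :=
  if detected_infeasible I j then None else predicted I j.

Lemma ratio_le_Rmax (i : 'I_n) (j : 'I_m) : bid I i j <= Rmax I * budget I i.
Proof.
rewrite -ler_pdivrMr ?budget_gt0//.
exact: (@le_bigmax _ _ _ _ (fun p : 'I_n * 'I_m => bid I p.1 p.2 / budget I p.1)
  (i, j)).
Qed.

Lemma bid0_ge0 (o : option 'I_n) (j : 'I_m) : 0 <= bid0 I o j.
Proof. by case: o => //= i; exact: bid_ge0. Qed.

(* It suffices to look at the last followed item: the prediction was still
   feasible when it arrived. *)
Lemma sum_followed_le (i : 'I_n) :
  \sum_(j | followed j == Some i) bid I i j <= budget I i.
Proof.
have [j0 fj0|none] := pickP (fun j => followed j == Some i); last first.
  by rewrite big_pred0// ltW// budget_gt0.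
have [j fj jmax] := @arg_maxnP _ j0 (fun j => followed j == Some i) val fj0.
have /negbFE/forallP/(_ i) : detected_infeasible I j = false.
  by move: fj; rewrite /followed; case: ifP.
apply: le_trans; rewrite big_mkcond [leRHS]big_mkcond; apply: ler_sum => l _.
case: ifPn => fl; last by case: ifP => // _; exact: bid_ge0.
rewrite ifT//; apply/andP; split; first exact: jmax.
by move: fl; rewrite /followed; case: ifP.
Qed.

Lemma opt_le_dual (y : 'I_n -> R) (z : 'I_m -> R) :
  (forall i, 0 <= y i) -> (forall j, 0 <= z j) ->
  (forall i j, bid I i j <= bid I i j * y i + z j) ->
  opt I <= \sum_i budget I i * y i + \sum_j z j.
Proof.
move=> y0 z0 yz; apply: ge_sup.
  (* [ge_sup] needs a nonempty set; selling nothing is feasible. *)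
  exists (revenue I 0), 0 => //; split => [i j|j|i].
  - by rewrite mxE.
  - by rewrite big1// => i _; rewrite mxE.
  - by rewrite big1 ?ltW ?budget_gt0// => j _; rewrite mxE mulr0.
move=> _ [x [x0 x1 xB] <-].
(* Each dual constraint is multiplied by [x i j]. The [y] terms are then bounded by the budgets, the
   [z] terms by the unit supply of each item. *)
apply: (@le_trans _ _ (\sum_i \sum_j (bid I i j * x i j * y i + z j * x i j))).
  apply: ler_sum => i _; apply: ler_sum => j _.
  by have := ler_wpM2r (x0 i j) (yz i j); lra.
under eq_bigr do rewrite big_split/= -mulr_suml.
rewrite big_split/= lerD//.
  by apply: ler_sum => i _; rewrite ler_wpM2r.
rewrite exchange_big; apply: ler_sum => j _.
by rewrite -mulr_sumr ler_piMr.
Qed.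

(** * Primal invariants of an execution *)

Variables (eta C : R).
Hypotheses (eta_ge0 : 0 <= eta) (eta_le1 : eta <= 1) (C_gt1 : 1 < C).

(** The weight [f] is left free: bids give the revenue of the item, the indicator of real buyers
    gives the fraction sold. *)
Lemma step_column (f : option 'I_n -> R) (j : 'I_m) (i : option 'I_n)
    (st : state R n m) : f None = 0 ->
  \sum_k f (Some k) * sx (step eta C I j i st) (Some k) j =
  if bid0 I i j < bid0 I (followed j) j
  then f i * eta + f (followed j) * (1 - eta) else f i.
Proof.
move=> f0; rewrite /= eqxx/= -/(followed j); case: ifPn => [lt|_]; last first.
  by rewrite sum_option_pick// mulr1.
(* The strict inequality of bids separates the two buyers, so the nested conditionals are a sum of
   two disjoint picks. *)
have ne : i != followed j by apply: contraTneq lt => ->; rewrite ltxx.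
rewrite -!sum_option_pick// -big_split/=; apply: eq_bigr => k _.
case: eqP => [->|_]; last by rewrite mulr0 add0r.
by rewrite (negbTE ne) mulr0 addr0.
Qed.

Lemma sx_step_neq (j : 'I_m) (i : option 'I_n) (st : state R n m) k l :
  l != j -> sx (step eta C I j i st) k l = sx st k l.
Proof. by move=> /= ->. Qed.

(** An arriving item still has its initial data, so its step purely adds a term to each sum over
    items. *)
Lemma exec_future (t : nat) (st : state R n m) : exec eta C I t st ->
  forall l : 'I_m, (t <= l)%N ->
    [/\ forall o, sx st o l = 0, sz st l = 0 & forall o, l \notin sM st o].
Proof.
elim=> [|j i {}st _ IH _] l tl; first by split => // o; rewrite inE.
have [x0 z0 M0] := IH l (ltnW tl).
have lj : l != j by apply: contraTneq tl => ->; rewrite ltnn.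
split=> [p| |p] /=; rewrite ?lj//.
by case: ifP => _; rewrite ?inE ?negb_or ?lj ?M0.
Qed.

Lemma exec_sx_ge0 (t : nat) (st : state R n m) : exec eta C I t st ->
  forall o l, 0 <= sx st o l.
Proof.
elim=> [//|j i {}st _ IH _] o l /=; case: ifP => // _.
by do !case: ifP => _ //; rewrite subr_ge0.
Qed.

Lemma exec_column_le1 (t : nat) (st : state R n m) : exec eta C I t st ->
  forall l, \sum_i sx st (Some i) l <= 1.
Proof.
elim=> [|j i {}st _ IH _] l; first by rewrite big1.
have [->|lj] := eqVneq l j; last by under eq_bigr do rewrite sx_step_neq//.
have := @step_column (fun o => (o != None)%:R) j i st erefl.
under eq_bigr do rewrite mul1r; move=> ->.
by do 2!case: eqP => _ /=; case: ifP => _; rewrite ?mul0r ?mul1r; move: eta_ge0 eta_le1; lra.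
Qed.

(** The winner is charged the whole item even when it gets only [eta]. This separates the budget
    spent on won items from that spent on followed predictions. *)
Lemma exec_sx_le (t : nat) (st : state R n m) : exec eta C I t st ->
  forall i l, sx st (Some i) l <=
    (l \in sM st (Some i))%:R + (1 - eta) * (followed l == Some i)%:R.
Proof.
have e1 : 0 <= 1 - eta by rewrite subr_ge0.
elim=> [|j i {}st _ IH _] k l; first by rewrite inE add0r mulr_ge0.
have [->|lj] := eqVneq l j; last first.
  rewrite sx_step_neq//; apply: le_trans (IH _ _) _; rewrite lerD2r/=.
  by case: ifP => // _; rewrite !inE (negbTE lj).
rewrite /= eqxx -/(followed j) (eq_sym (followed j)).
have [_|_] := eqVneq (Some k) i.
  by rewrite setU11; case: ifP => _; case: eqP => _ /=; move: eta_ge0 eta_le1; lra.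
have M0 : 0 <= (j \in sM st (Some k))%:R :> R by [].
by case: ifP => _; case: eqP => _ /=; move: M0 eta_ge0 eta_le1; lra.
Qed.

(** A split item gives the share [1 - eta] to the followed buyer; an unsplit one goes to a winner
    bidding at least as much. *)
Lemma exec_followed_revenue (t : nat) (st : state R n m) : exec eta C I t st ->
  forall l : 'I_m, (l < t)%N -> (1 - eta) * bid0 I (followed l) l <=
    \sum_i bid I i l * sx st (Some i) l.
Proof.
elim=> [//|j i {}st _ IH _] l; rewrite ltnS leq_eqVlt => /predU1P[/val_inj->|lj].
  rewrite (@step_column (bid0 I ^~ j))//.
  have := bid0_ge0 i j; have := bid0_ge0 (followed j) j.
  by case: ifPn; rewrite -?leNgt; move: eta_ge0 eta_le1; nra.
rewrite (le_trans (IH l lj))//; apply: ler_sum => k _; rewrite sx_step_neq//.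
by apply: contraTneq lj => ->; rewrite ltnn.
Qed.

(** * Dual invariants of an execution *)

Lemma exec_sy_ge0 (t : nat) (st : state R n m) : exec eta C I t st ->
  forall i, 0 <= sy st i.
Proof.
elim=> [//|j o {}st _ IH _] i /=; case: ifP => // _.
have bB : 0 <= bid I i j / budget I i by rewrite divr_ge0 ?bid_ge0 ?ltW ?budget_gt0.
have C0 : 0 <= 1 / (C - 1) by rewrite divr_ge0// subr_ge0 ltW.
exact: addr_ge0 (mulr_ge0 (IH i) (addr_ge0 ler01 bB)) (mulr_ge0 bB C0).
Qed.

Lemma sy_step_ge (t : nat) (st : state R n m) (j : 'I_m) (o : option 'I_n) :
  exec eta C I t st -> forall i, sy st i <= sy (step eta C I j o st) i.
Proof.
move=> /exec_sy_ge0 y0 i /=; case: ifP => // _.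
have bB : 0 <= bid I i j / budget I i by rewrite divr_ge0 ?bid_ge0 ?ltW ?budget_gt0.
have C0 : 0 <= 1 / (C - 1) by rewrite divr_ge0// subr_ge0 ltW.
rewrite mulrDr mulr1 -addrA lerDl.
exact: addr_ge0 (mulr_ge0 (y0 i) bB) (mulr_ge0 bB C0).
Qed.

(** On arrival of the item, [z] dominates every score [b (1 - y)]; afterwards [z] is fixed and [y]
    only grows. *)
Lemma exec_dual_feasible (t : nat) (st : state R n m) : exec eta C I t st ->
  forall i (l : 'I_m), (l < t)%N -> bid I i l <= bid I i l * sy st i + sz st l.
Proof.
elim=> [//|j o {}st ex IH sel] i l.
rewrite ltnS leq_eqVlt => /predU1P[/val_inj->|lj].
  have y' := ler_wpM2l (bid_ge0 I i j) (sy_step_ge j o ex i).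
  suff: bid I i j * (1 - sy st i) <= sz (step eta C I j o st) j by move: y'; lra.
  rewrite /= eqxx/=; case: o sel {y'} => [k [kmax _]|]; last by apply.
  by rewrite le_max kmax orbT.
have y' := ler_wpM2l (bid_ge0 I i l) (sy_step_ge j o ex i).
have -> : sz (step eta C I j o st) l = sz st l.
  by rewrite /= ifT//; apply: contraTneq lj => ->; rewrite ltnn.
by rewrite (le_trans (IH i l lj))// lerD2r.
Qed.

Lemma exec_sz_ge0 (t : nat) (st : state R n m) : exec eta C I t st ->
  forall l, 0 <= sz st l.
Proof.
elim=> [//|j o {}st _ IH _] l /=; case: ifP => // _.
by case: o => // k; rewrite le_max lexx.
Qed.

(* An item won by [i] with bid [b] raises the dual objective by
   [b (1 - y_i) + b y_i + b / (C - 1) = b C / (C - 1)]. *)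
Lemma exec_dual_le (t : nat) (st : state R n m) : exec eta C I t st ->
  (1 - 1 / C) * (\sum_i budget I i * sy st i + \sum_l sz st l) <=
  \sum_l \sum_i bid I i l * sx st (Some i) l.
Proof.
have C0 : 0 < C by rewrite (lt_trans ltr01).
elim=> [|j o {}st ex IH sel].
  rewrite big1 ?add0r/=; last by move=> i _; rewrite mulr0.
  by rewrite big1// mulr0 !big1// => l _; rewrite big1// => i _; rewrite mulr0.
have [x0 z0 _] := exec_future ex (leqnn j).
rewrite [in leRHS](@sum_update _ _ j
  (fun l => \sum_i bid I i l * sx st (Some i) l)); first last.
- by rewrite big1// => i _; rewrite x0 mulr0.
- by move=> l lj; apply: eq_bigr => i _; rewrite sx_step_neq.
rewrite (@step_column (bid0 I ^~ j))//.
rewrite (@sum_update _ _ j (sz st) (sz (step eta C I j o st))); first last.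
- exact: z0.
- by move=> l lj; rewrite /= lj.
(* An item is split only towards a higher bid, so the convex combination is at least the winning
   bid. *)
have rev : bid0 I o j <= if bid0 I o j < bid0 I (followed j) j
    then bid0 I o j * eta + bid0 I (followed j) j * (1 - eta) else bid0 I o j.
  by case: ifPn => // /ltW; move: eta_ge0 eta_le1; nra.
apply: le_trans (lerD IH rev); rewrite {rev}.
case: o sel => [k [_ k0]|_]; last by rewrite /= eqxx/= !addr0.
have zj : sz (step eta C I j (Some k) st) j = bid I k j * (1 - sy st k).
  by rewrite /= eqxx/= max_r// ltW.
rewrite zj (bigD1 k)//= [in leRHS](bigD1 k)//= eqxx.
rewrite (eq_bigr (fun i => budget I i * sy st i)); last first.
  by move=> i /negbTE ik; rewrite (inj_eq Some_inj) ik.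
have Bk := budget_gt0 I k.
rewrite le_eqVlt; apply/orP; left; apply/eqP.
have C10 : C - 1 != 0 by rewrite subr_eq0 gt_eqF.
by field; rewrite C10 !gt_eqF.
Qed.

(** With [a = b / B], the update of [y] multiplies [1 + (C - 1) y] by exactly [1 + a], while the
    left side is multiplied by [(1 + r)^(a / r)], at most [1 + a] by Bernoulli. *)
Lemma exec_powR_load_le (r : R) (t : nat) (st : state R n m) : 0 < r ->
  (forall i j, bid I i j <= r * budget I i) -> exec eta C I t st -> forall i,
  (1 + r) `^ ((\sum_(l in sM st (Some i)) bid I i l) / budget I i / r) <=
  1 + (C - 1) * sy st i.
Proof.
move=> r0 small; elim=> [|j o {}st ex IH _] i.
  by rewrite big_set0 !mul0r powRr0 mulr0 addr0.
rewrite /=; case: ifP => // _.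
have [_ _ M0] := exec_future ex (leqnn j).
rewrite big_setU1//= addrC !mulrDl powRD; last first.
  by apply/implyP => _; rewrite lt0r_neq0// addr_gt0.
have b0 := bid_ge0 I i j; have B0 := budget_gt0 I i.
set a := bid I i j / budget I i.
(* Here the bids being small relative to the budgets keeps the Bernoulli exponent at most 1. *)
have ar : 0 <= a / r <= 1.
  by rewrite !divr_ge0 ?(ltW B0) ?(ltW r0)//= !ler_pdivrMr// mul1r.
apply: le_trans (ler_pM _ _ (IH i) (powR1D_le (ltW r0) ar)) _; rewrite ?powR_ge0//.
rewrite le_eqVlt; apply/orP; left; apply/eqP.
have C10 : C - 1 != 0 by rewrite subr_eq0 gt_eqF.
by field; rewrite C10 gt_eqF.
Qed.

End Execution.

(** * Bounding the excess over the budgets *)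

(** Just before [i] wins an item its score is positive, so [y < 1] and its load is at most [eta B];
    the new bid adds at most [Rmax I * B]. *)
Lemma exec_load_le (R : realType) (n m : nat) (I : instance R n m) (eta : R)
    (t : nat) (st : state R n m) : 0 < eta -> 0 < Rmax I ->
  exec eta (Cconst eta (Rmax I)) I t st ->
  forall i, \sum_(l in sM st (Some i)) bid I i l <= (eta + Rmax I) * budget I i.
Proof.
move=> eta0 r0; have C1 := Cconst_gt1 eta0 r0.
elim=> [|j o {}st ex IH sel] i.
  by rewrite big_set0 mulr_ge0 ?addr_ge0// ltW// budget_gt0.
rewrite /=; case: eqP => // oi; move: sel; rewrite -oi => -[_ score_gt0].
have [_ _ M0] := exec_future ex (leqnn j).
rewrite big_setU1//= addrC mulrDl lerD ?ratio_le_Rmax//.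
have y1 : sy st i < 1.
  rewrite ltNge; apply: contraTN score_gt0; rewrite -leNgt => y1.
  by rewrite mulr_ge0_le0 ?bid_ge0 ?subr_le0.
have := exec_powR_load_le C1 r0 (@ratio_le_Rmax _ _ _ I) ex i.
apply: contraTT; rewrite -!ltNge => S.
(* A load above [eta B] would make the power at least [(1 + r)^(eta / r) = C], whereas [y < 1] gives
   [1 + (C - 1) y < C]. *)
apply: (@lt_le_trans _ _ (Cconst eta (Rmax I))).
  by rewrite -ltrBDl -ltr_pdivlMl ?subr_gt0// mulVf// subr_eq0 gt_eqF.
apply: ler_powR; first by rewrite lerDl ltW.
by rewrite ler_pM2r ?invr_gt0// ler_pdivlMr ?budget_gt0// ltW.
Qed.

Lemma exec_budget_le (R : realType) (n m : nat) (I : instance R n m)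
    (eta : R) (st : state R n m) : 0 < eta -> eta <= 1 -> 0 < Rmax I ->
  exec eta (Cconst eta (Rmax I)) I m st ->
  forall i, \sum_j bid I i j * sx st (Some i) j <= (1 + Rmax I) * budget I i.
Proof.
move=> eta0 eta1 r0 ex i.
(* The first summand pays for the items won, the second for the followed predictions. *)
have -> : (1 + Rmax I) * budget I i =
    (eta + Rmax I) * budget I i + (1 - eta) * budget I i by lra.
apply: le_trans (lerD (exec_load_le eta0 r0 ex i)
  (ler_wpM2l (_ : 0 <= 1 - eta) (sum_followed_le I i))); last by rewrite subr_ge0.
rewrite mulr_sumr [X in _ <= X + _]big_mkcond [X in _ <= _ + X]big_mkcond.
rewrite -big_split/=.
apply: ler_sum => j _.
have := ler_wpM2l (bid_ge0 I i j) (exec_sx_le (ltW eta0) eta1 ex i j).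
by move/le_trans; apply; case: (j \in _); case: (followed I j == _) => /=; lra.
Qed.

(** * The limit of the robustness for small bids *)

(** This is the difference quotient of [ln] at 1, where the derivative is 1. *)
Lemma ln1D_div_cvg (R : realType) : ln (1 + r) / r @[r --> (0 : R)^'] --> (1 : R).
Proof.
have [d D1] := @is_derive1_ln R 1 ltr01.
have {d} : h^-1 *: (ln (h *: 1 + 1) - ln 1) @[h --> (0 : R)^'] --> 'D_1 (@ln R) 1 := d.
rewrite D1 invr1; apply: cvg_trans; apply: near_eq_cvg; near=> r.
by rewrite ln1 subr0 mulrC addrC /GRing.scale/= mulr1.
Unshelve. all: by end_near. Qed.

Lemma robustness_cvg (R : realType) (eta : R) :
  robustness eta r @[r --> 0^'+] --> 1 - expR (- eta).
Proof.
(* For [r > 0], [1 / C] is the exponential of [- eta * (ln (1 + r) / r)]. *)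
have lim : (1 - expR (- (eta * (ln (1 + r) / r)))) / (1 + r) @[r --> (0 : R)^'+]
    --> (1 - expR (- (eta * 1))) / (1 + 0).
  apply: cvgM; last first.
    apply: cvgV; first by rewrite addr0 oner_neq0.
    apply: cvgD; first exact: cvg_cst.
    by apply: cvg_at_right_filter; exact: cvg_id.
  apply: cvgB; first exact: cvg_cst.
  apply: continuous_cvg; first exact: continuous_expR.
  apply: cvgN; apply: cvgM; first exact: cvg_cst.
  by apply: cvg_dnbhs_at_right; exact: ln1D_div_cvg.
rewrite mulr1 addr0 divr1 in lim.
apply: cvg_trans lim; apply: near_eq_cvg; near=> r.
have r0 : 0 < r by near: r; exact: nbhs_right_gt.
rewrite /robustness /Cconst /powR gt_eqF ?addr_gt0// div1r -expRN.
by rewrite mulrAC mulrA.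
Unshelve. all: by end_near. Qed.

Theorem theorem2 (R : realType) (eta : R) (eta_gt0 : 0 < eta)
    (eta_le1 : eta <= 1) :
  [/\ forall r : R, 0 < r -> r <= 1 ->
        consistent_robust r (algorithm2 eta r) (1 - eta) (robustness eta r),
      forall r : R, 0 < r -> r <= 1 ->
        forall (n m : nat) (I : instance R n m) (x : 'M[R]_(n, m)),
          Rmax I = r -> algorithm2 eta r I x ->
          feasible I ((1 + r)^-1 *: x) /\
          robustness eta r * opt I <= revenue I ((1 + r)^-1 *: x)
    & robustness eta r @[r --> 0^'+] --> 1 - expR (- eta)].
Proof.
have rev_scaled (r : R) n m (I : instance R n m) x : revenue I ((1 + r)^-1 *: x) =
    revenue I x / (1 + r).
  rewrite /revenue mulr_suml; apply: eq_bigr => i _; rewrite mulr_suml.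
  by apply: eq_bigr => j _; rewrite mxE mulrCA mulrC.
(* The primal-dual bound holds without the factor [1 / (1 + r)]; this factor is the price of scaling
   the output down to a feasible solution. *)
have robust (r : R) n m (I : instance R n m) x : 0 < r ->
    algorithm2 eta r I x -> robustness eta r * opt I <= revenue I x / (1 + r).
  move=> r0 [st ex ->]; rewrite /robustness mulrAC.
  rewrite ler_pM2r ?invr_gt0 ?addr_gt0//.
  have C1 := Cconst_gt1 eta_gt0 r0.
  apply: le_trans (le_trans _ (exec_dual_le (ltW eta_gt0) eta_le1 C1 ex)) _.
    apply: ler_wpM2l; first by rewrite subr_ge0 div1r invf_le1 ?(lt_trans ltr01 C1)// ltW.
    apply: opt_le_dual; [exact: exec_sy_ge0 ex|exact: exec_sz_ge0 ex|].
    by move=> i j; apply: (exec_dual_feasible C1 ex); exact: ltn_ord.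
  rewrite exchange_big/= /revenue le_eqVlt; apply/orP; left; apply/eqP.
  by apply: eq_bigr => i _; apply: eq_bigr => j _; rewrite mxE.
have x_ge0 (r : R) n m (I : instance R n m) x i j : algorithm2 eta r I x -> 0 <= x i j.
  by move=> [st ex ->]; rewrite mxE; exact: (exec_sx_ge0 (ltW eta_gt0) eta_le1 ex).
split; last exact: robustness_cvg.
- move=> r r0 _ n m I x Ir alg; rewrite ge_max; apply/andP; split; last first.
    (* The revenue is nonnegative, so undoing the scaling can only increase it. *)
    apply: le_trans (robust _ _ _ _ _ r0 alg) _.
    rewrite ler_pdivrMr ?addr_gt0// ler_peMr ?lerDl ?(ltW r0)//.
    apply: sumr_ge0 => i _; apply: sumr_ge0 => j _.
    by rewrite mulr_ge0 ?bid_ge0//; exact: x_ge0 alg.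
  case: alg => st ex ->.
  (* Bids are nonnegative, so no prefix of a feasible prediction is detected as infeasible, and the
     prediction is followed throughout. *)
  have -> : prediction_revenue I =
      if prediction_feasible I then \sum_j bid0 I (followed I j) j else 0.
    rewrite /prediction_revenue; case: ifP => // /forallP feas.
    apply: eq_bigr => j _; rewrite /followed ifF//; apply/negbTE; rewrite negbK.
    apply/forallP => i; apply: le_trans (feas i).
    rewrite big_mkcond [leRHS]big_mkcond; apply: ler_sum => l _.
    by case: (predicted I l == Some i); rewrite ?andbF//; case: ifP => // _; exact: bid_ge0.
  have rev_ge : (1 - eta) * \sum_j bid0 I (followed I j) j <=
      revenue I (\matrix_(i, j) sx st (Some i) j).
    rewrite /revenue exchange_big mulr_sumr; apply: ler_sum => j _.
    under eq_bigr do rewrite mxE.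
    exact: (exec_followed_revenue (ltW eta_gt0) eta_le1 ex (ltn_ord j)).
  case: ifP => // _; apply: le_trans rev_ge; rewrite mulr0 mulr_ge0 ?subr_ge0//.
  by apply: sumr_ge0 => j _; exact: bid0_ge0.
- move=> r r0 _ n m I x Ir alg; rewrite rev_scaled; split; last exact: robust alg.
  have r1 : 0 < (1 + r)^-1 by rewrite invr_gt0 addr_gt0.
  split=> [i j|j|i].
  + by rewrite mxE mulr_ge0 ?(ltW r1)//; exact: x_ge0 alg.
  + under eq_bigr do rewrite mxE; rewrite -mulr_sumr mulrC ler_pdivrMr ?addr_gt0//.
    case: alg => st ex ->; under eq_bigr do rewrite mxE.
    apply: le_trans (exec_column_le1 (ltW eta_gt0) eta_le1 ex j) _.
    by rewrite mul1r lerDl ltW.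
  + under eq_bigr do rewrite mxE mulrCA.
    rewrite -mulr_sumr mulrC ler_pdivrMr ?addr_gt0// [leRHS]mulrC.
    case: alg => st; rewrite -Ir => ex ->; under eq_bigr do rewrite mxE.
    by apply: (exec_budget_le eta_gt0 eta_le1 _ ex); rewrite Ir.
Qed.
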